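(* Let $\lambda\in(0,1]$ and let $k\ge 0$ be a fixed integer. Suppose that $n$ and $M$ are integer variables with $n\le M$ and both increase tending to infinity while their ratio $n/M$ tends to $\lambda$. For each such pair, let $\mathcal{M}$ be a set with $M$ elements, let $\mathcal{N}\subset\mathcal{M}$ be a subset with $n$ elements, let $\mathcal{T}=\mathcal{M}^n$, and put $$A(k;M,n)=\frac{1}{|\mathcal{T}|}\sum_{\mathbf{x}\in\mathcal{T}}\frac{m_k(\mathbf{x})}{n},\qquad M_2(k;M,n)=\frac{1}{|\mathcal{T}|}\sum_{\mathbf{x}\in\mathcal{T}}\left(\frac{m_k(\mathbf{x})}{n}-\frac{\lambda^k}{k!}e^{-\lambda}\right)^2.$$ Then $$\lim_{\substack{n,M\to\infty\\ n/M\to\lambda}}A(k;M,n)=\frac{\lambda^k}{k!}e^{-\lambda}\quad\text{and}\quad\lim_{\substack{n,M\to\infty\\ n/M\to\lambda}}M_2(k;M,n)=0.$$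
   Context: For a finite set $\mathcal{M}$ with $M$ elements and a subset $\mathcal{N}\subset\mathcal{M}$ with $n$ elements, $\mathcal{T}=\mathcal{M}^n$ is the set of $n$-tuples $\mathbf{x}=(x_1,\dots,x_n)$ with components in $\mathcal{M}$. An element $y\in\mathcal{N}$ is represented exactly $k$ times in $\mathbf{x}\in\mathcal{T}$ if exactly $k$ of the components $x_1,\dots,x_n$ are equal to $y$. The counter $m_k(\mathbf{x})$ is the number of elements $y\in\mathcal{N}$ that are represented exactly $k$ times in $\mathbf{x}$. (The quantities $A(k;M,n)$ and $M_2(k;M,n)$ depend only on the sizes $M$ and $n$, on $k$ and, for $M_2$, on $\lambda$.) *)

(* Defs.v *)
From mathcomp Require Import all_boot all_order all_algebra.
From mathcomp Require Import all_classical all_reals all_analysis.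
Import Order.TTheory GRing.Theory Num.Theory.
Import numFieldNormedType.Exports.

Set Implicit Arguments.
Unset Strict Implicit.
Unset Printing Implicit Defensive.

Local Open Scope classical_set_scope.
Local Open Scope ring_scope.

Definition represented (T : finType) (n : nat) (k : nat) (y : T)
    (x : n.-tuple T) : bool :=
  count_mem y x == k.

Definition counter (T : finType) (N : {set T}) (n k : nat)
    (x : n.-tuple T) : nat :=
  #|[set y in N | represented k y x]%SET|.

Definition tuple_mean (R : realType) (T : finType) (n : nat)
    (f : n.-tuple T -> R) : R :=
  #|{: n.-tuple T}|%:R^-1 * \sum_(x : n.-tuple T) f x.

Definition poisson_weight (R : realType) (lambda : R) (k : nat) : R :=
  lambda ^+ k / k`!%:R * expR (- lambda).

(* The tuples averaged over have length n = #|N|, the size of the subset. *)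
Definition counter_mean (R : realType) (T : finType) (N : {set T})
    (k : nat) : R :=
  tuple_mean (fun x : #|N|.-tuple T => (counter N k x)%:R / #|N|%:R).

Definition counter_moment2 (R : realType) (lambda : R) (T : finType)
    (N : {set T}) (k : nat) : R :=
  tuple_mean (fun x : #|N|.-tuple T =>
    ((counter N k x)%:R / #|N|%:R - poisson_weight lambda k) ^+ 2).

(* Joint limit over pairs (M, n) : n <= M, both tending to infinity, with
   n / M tending to lambda; no monotonicity or path is imposed. *)
Definition ratio_limit (R : realType) (lambda : R) : set_system (nat * nat) :=
  filter_from [set d : nat * R | 0 < d.2]
    (fun d => [set p : nat * nat |
      [/\ (p.2 <= p.1)%N, (d.1 <= p.1)%N, (d.1 <= p.2)%N
        & `|p.2%:R / p.1%:R - lambda| < d.2]]).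

Global Instance ratio_limit_filter (R : realType) (lambda : R) :
  Filter (ratio_limit lambda).
Proof.
apply: filter_from_filter; first by exists (0%N, 1) => /=.
move=> [a d] [b e] /= d0 e0.
exists (maxn a b, Num.min d e); first by rewrite /= lt_min d0.
move=> [M n] /= [nM]; rewrite !geq_max lt_min.
by move=> /andP[aM bM] /andP[an bn] /andP[hd he]; split; split.
Qed.

(* So limits along the filter are unique and statements about it not vacuous;
   the witnesses are the pairs (M, floor (lambda * M)) for large M. *)
Lemma ratio_limit_proper (R : realType) (lambda : R) :
  0 < lambda <= 1 -> ProperFilter (ratio_limit lambda).
Proof.
move=> /andP[l0 l1]; apply: filter_from_proper.
move=> [a d] /= d0.
pose c := (a.+1%:R / lambda + d^-1 : R).
have c0 : 0 < c by rewrite addr_gt0 ?divr_gt0 ?invr_gt0.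
pose M := (Num.truncn c).+1.
have cM : c < M%:R by exact: truncnS_gt.
have M0 : 0 < M%:R :> R by rewrite ltr0n.
have lM0 : 0 <= lambda * M%:R by rewrite mulr_ge0 ?ltW.
pose n := Num.truncn (lambda * M%:R).
have /andP[nl nu] : n%:R <= lambda * M%:R < n.+1%:R by exact: truncn_itv.
have nM : (n <= M)%N.
  rewrite -(ler_nat R); apply: (le_trans nl).
  by rewrite ler_piMl// ltW.
have an : (a <= n)%N.
  rewrite -ltnS -(ltr_nat R); apply: le_lt_trans nu.
  rewrite mulrC -ler_pdivrMr//; apply: ltW; apply: le_lt_trans cM.
  apply: (@le_trans _ _ (a.+1%:R / lambda)).
    by rewrite ler_pM2r ?invr_gt0// ler_nat.
  by rewrite lerDl invr_ge0 ltW.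
exists (M, n); split => //=; first exact: leq_trans nM.
have dM : d^-1 < M%:R.
  by rewrite (le_lt_trans _ cM)// /c lerDr divr_ge0// ltW.
have -> : n%:R / M%:R - lambda = (n%:R - lambda * M%:R) / M%:R :> R.
  by rewrite mulrBl mulfK ?gt_eqF.
rewrite normrM normfV (gtr0_norm M0) ltr_pdivrMr// distrC ger0_norm ?subr_ge0//.
apply: (@lt_trans _ _ 1); first by rewrite ltrBlDr addrC natr1.
by rewrite mulrC -ltr_pdivrMr// div1r.
Qed.

(* Main.v *)
Require Import Defs.
From mathcomp Require Import all_boot all_order all_algebra.
From mathcomp Require Import all_classical all_reals all_analysis.
From mathcomp Require Import ring.
Import Order.TTheory GRing.Theory Num.Theory.
Import numFieldNormedType.Exports.

(** The counter m_k is the sum over y in N of the indicators of the events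
  E_y: y occurs exactly k times in x.  For x uniform in T^n, the mean of m_k/n
  is therefore the probability p1 of one such event, and, splitting the square
  of the sum into diagonal and off-diagonal terms, the mean of (m_k/n)^2 is
  p1/n + (1 - 1/n) p2, where p2 is the probability that E_y and E_z both hold
  for two distinct points y and z.

  Both probabilities are instances of one multinomial count
  ([card_prescribed]): if r distinct letters get prescribed multiplicities of
  sum K, the number of words of length n over M letters realizing them, times
  the product of the factorials of the multiplicities, is
  n^_K (M - r)^(n - K).  Along the joint limit, n^_K / M^K tends to lambda^K
  and (1 - r/M)^(n - K) tends to exp(- r lambda) ([ratio_limit_occurrence]).
  Hence p1 tends to the Poisson weight w = lambda^k exp(- lambda) / k!, and p2,
  for which r = 2 and K = 2k, tends to w^2: the events E_y and E_z are
  asymptotically independent.  The first claim is the limit of p1; the second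
  moment around w, expanded, is p1/n + (1 - 1/n) p2 - 2 w p1 + w^2, whose limit
  is 0 + w^2 - 2 w^2 + w^2 = 0. *)

Set Implicit Arguments.
Unset Strict Implicit.
Unset Printing Implicit Defensive.

Local Open Scope classical_set_scope.
Local Open Scope ring_scope.

(** * Words with prescribed letter multiplicities *)

Lemma sum_tupleS (T : finType) (n : nat) (F : n.+1.-tuple T -> nat) :
  (\sum_x F x = \sum_(a : T) \sum_(x : n.-tuple T) F (cons_tuple a x))%N.
Proof.
rewrite pair_big /=.
rewrite (reindex (fun p : T * n.-tuple T => cons_tuple p.1 p.2)) //=.
exists (fun x => (thead x, [tuple of behead x])) => [[a x] _|x _] /=.
  by congr pair; apply: val_inj.
by rewrite [in RHS](tuple_eta x); apply: val_inj.
Qed.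

Definition prescribed {T : finType} (S : {set T}) (kappa : T -> nat)
    {n : nat} (x : n.-tuple T) : bool :=
  [forall y in S, count_mem y x == kappa y].

(** What a word headed by [a] still asks of its tail; it is only used when
  [kappa a] is positive, so that the truncated subtraction is exact. *)
Definition lower {T : eqType} (a : T) (kappa : T -> nat) : T -> nat :=
  fun y => (kappa y - (y == a))%N.

Lemma prescribed_cons_notin (T : finType) (S : {set T}) (kappa : T -> nat)
    (n : nat) (a : T) (x : n.-tuple T) :
  a \notin S -> prescribed S kappa (cons_tuple a x) = prescribed S kappa x.
Proof.
move=> aS; apply: eq_forallb => y; case: (boolP (y \in S)) => //= yS.
by case: (eqVneq a y) aS => [->|_] //; rewrite yS.
Qed.

Lemma prescribed_cons_in (T : finType) (S : {set T}) (kappa : T -> nat)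
    (n : nat) (a : T) (x : n.-tuple T) :
  a \in S -> prescribed S kappa (cons_tuple a x) =
    (0 < kappa a)%N && prescribed S (lower a kappa) x.
Proof.
move=> aS; apply/forall_inP/andP => [h|[k0 /forall_inP h] y yS].
  split; first by move/eqP: (h a aS) => /= <-; rewrite eqxx.
  apply/forall_inP => y yS; rewrite /lower; move/eqP: (h y yS) => /= <-.
  by rewrite (eq_sym y) addKn.
rewrite /= (eqP (h y yS)) /lower (eq_sym a).
by case: (eqVneq y a) => [->|_]; rewrite ?subn0 // subnKC.
Qed.

Lemma lower_head (T : eqType) (kappa : T -> nat) (a : T) :
  lower a kappa a = (kappa a).-1.
Proof. by rewrite /lower eqxx subn1. Qed.

Lemma lower_neq (T : eqType) (kappa : T -> nat) (a y : T) :
  y != a -> lower a kappa y = kappa y.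
Proof. by move=> /negbTE ya; rewrite /lower ya subn0. Qed.

Lemma sum_lower (T : finType) (S : {set T}) (kappa : T -> nat) (a : T) :
  a \in S -> (0 < kappa a)%N ->
  (\sum_(y in S) kappa y = (\sum_(y in S) lower a kappa y).+1)%N.
Proof.
move=> aS k0; rewrite (bigD1 a) //= [in RHS](bigD1 a) //= lower_head.
rewrite -addSn prednK //; congr addn; apply: eq_bigr => y /andP[_ ya].
by rewrite lower_neq.
Qed.

Lemma prod_fact_lower (T : finType) (S : {set T}) (kappa : T -> nat) (a : T) :
  a \in S -> (0 < kappa a)%N ->
  (\prod_(y in S) (kappa y)`! = kappa a * \prod_(y in S) (lower a kappa y)`!)%N.
Proof.
move=> aS k0; rewrite (bigD1 a) //= [in RHS](bigD1 a) //= lower_head.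
rewrite mulnA -{1 2}(prednK k0) -factS; congr muln.
by apply: eq_bigr => y /andP[_ ya]; rewrite lower_neq.
Qed.

(** Induction on the length of the word: the letters outside [S] can head it
  without changing what is asked of the tail, and a letter [a] of [S] lowers
  its multiplicity by one, which turns the factorial weight into a factor
  [kappa a]; summed over [S] these factors give [K].  The step is then the
  falling factorial identity (n+1)^_K = K n^_(K-1) + n^_K.  Clearing the
  factorials keeps everything in the natural numbers, and the falling
  factorial takes care of the case [n < K], where both sides vanish. *)
Lemma card_prescribed (T : finType) (S : {set T}) (n : nat) (kappa : T -> nat) :
  let K := (\sum_(y in S) kappa y)%N in
  ((\prod_(y in S) (kappa y)`!) * (\sum_(x : n.-tuple T) prescribed S kappa x)
    = n ^_ K * (#|T| - #|S|) ^ (n - K))%N.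
Proof.
elim: n kappa => [|n IH] kappa /=.
  rewrite (big_pred1 [tuple]) => [|x]; last exact/esym/eqP/tuple0.
  rewrite sub0n expn0 muln1.
  have [K0|/eqP K0] := eqVneq (\sum_(y in S) kappa y)%N 0%N.
    have k0 y : y \in S -> kappa y = 0%N.
      by move=> yS; move/eqP: K0; rewrite sum_nat_eq0 => /forall_inP/(_ y yS)/eqP.
    rewrite K0 ffactn0 big1 => [|y yS]; last by rewrite k0.
    suff -> : prescribed S kappa [tuple] by [].
    by apply/forall_inP => y yS; rewrite k0.
  rewrite ffact_small ?lt0n; last exact/eqP.
  apply/eqP; rewrite muln_eq0 eqb0; apply/orP; right; apply/negP => /forall_inP h.
  by apply: K0; apply: big1 => y yS; move/eqP: (h y yS) => /= <-.
rewrite sum_tupleS.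
set K := (\sum_(y in S) kappa y)%N.
set P := (\prod_(y in S) (kappa y)`!)%N.
set m := (#|T| - #|S|)%N.
have hin a : a \in S ->
    (P * \sum_(x : n.-tuple T) prescribed S kappa (cons_tuple a x) =
     kappa a * (n ^_ K.-1 * m ^ (n.+1 - K)))%N.
  move=> aS; under eq_bigr do rewrite prescribed_cons_in //.
  have [k0|] := posnP (kappa a); first by rewrite k0 big1 ?muln0.
  move=> k0; rewrite /= /P (prod_fact_lower aS k0) -mulnA IH.
  by rewrite /K (sum_lower aS k0) subSS.
have hout a : a \notin S ->
    (P * \sum_(x : n.-tuple T) prescribed S kappa (cons_tuple a x) =
     n ^_ K * m ^ (n - K))%N.
  by move=> aS; under eq_bigr do rewrite prescribed_cons_notin //; rewrite IH.
rewrite (bigID (mem S)) /= mulnDr !big_distrr /= (eq_bigr _ hin) (eq_bigr _ hout).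
rewrite -big_distrl sum_nat_const /= -/K.
have -> : #|[predC S]| = m by rewrite /m -(cardC (mem S)) addKn.
clear hin hout; clearbody K.
have [nK|Kn] := ltnP n K.
  rewrite (ffact_small nK) mul0n muln0 addn0.
  case: K nK => // K; rewrite ltnS => nK /=.
  have /eqP -> : (n.+1 - K.+1 == 0)%N by rewrite subn_eq0.
  rewrite !muln1; move: nK; rewrite leq_eqVlt => /orP[/eqP <-|nK].
    by rewrite !ffactnn factS.
  by rewrite !ffact_small // muln0.
rewrite (mulnCA m) -expnS -subSn // mulnA -mulnDl; congr muln.
case: K Kn => [|K] Kn; first by rewrite !ffactn0.
by rewrite /= ffactSS ffactnSr mulnC -mulnDr mulnC addSn subnKC // ltnW.
Qed.

(** * First and second moments of the counter *)

(** Divided by the product of the factorials of the prescribed multiplicities,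
  this is the probability that [r] distinct letters out of [M] occur in a
  random word of length [n] with given multiplicities of sum [K]. *)
Definition occurrence (R : realType) (r K n M : nat) : R :=
  (n ^_ K)%:R * ((M - r) ^ (n - K))%:R / (M ^ n)%:R.

Lemma tuple_mean_sum (R : realType) (T I : finType) (n : nat) (A : {set I})
    (f : I -> n.-tuple T -> R) :
  tuple_mean (fun x => \sum_(i in A) f i x) = \sum_(i in A) tuple_mean (f i).
Proof. by rewrite /tuple_mean exchange_big mulr_sumr. Qed.

Lemma tuple_meanZ (R : realType) (T : finType) (n : nat) (c : R)
    (f : n.-tuple T -> R) :
  tuple_mean (fun x => c * f x) = c * tuple_mean f.
Proof. by rewrite /tuple_mean -mulr_sumr mulrCA. Qed.

Lemma tuple_meanD (R : realType) (T : finType) (n : nat)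
    (f g : n.-tuple T -> R) :
  tuple_mean (fun x => f x + g x) = tuple_mean f + tuple_mean g.
Proof. by rewrite /tuple_mean big_split mulrDr. Qed.

Lemma tuple_mean_cst (R : realType) (T : finType) (n : nat) (c : R) :
  (0 < #|T|)%N -> tuple_mean (fun _ : n.-tuple T => c) = c.
Proof.
move=> T0; rewrite /tuple_mean sumr_const -[c *+ _]mulr_natl mulrA mulVf ?mul1r //.
by rewrite pnatr_eq0 card_tuple -lt0n expn_gt0 T0.
Qed.

Lemma tuple_mean_prescribed (R : realType) (T : finType) (S : {set T})
    (kappa : T -> nat) (n : nat) :
  tuple_mean (fun x : n.-tuple T => (prescribed S kappa x)%:R) =
  occurrence R #|S| (\sum_(y in S) kappa y)%N n #|T|
    / (\prod_(y in S) (kappa y)`!)%:R.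
Proof.
rewrite /tuple_mean /occurrence -natr_sum -natrM -card_prescribed card_tuple natrM.
set P := (\prod_(y in S) _)%N.
have P0 : P%:R != 0 :> R; last first.
  by rewrite mulrC mulrAC (mulrC P%:R) mulfK.
rewrite pnatr_eq0 -lt0n.
by apply: prodn_cond_gt0 => y _; exact: fact_gt0.
Qed.

Lemma tuple_mean_represented (R : realType) (T : finType) (n k : nat) (y : T) :
  tuple_mean (fun x : n.-tuple T => (represented k y x)%:R) =
  occurrence R 1 k n #|T| / k`!%:R.
Proof.
have := tuple_mean_prescribed R [set y]%SET (fun=> k) n.
rewrite cards1 !big_set1 => <-; congr tuple_mean; apply/funext => x.
congr (nat_of_bool _)%:R; apply/idP/forall_inP => [h z|h]; last by apply: h; rewrite inE.
by rewrite inE => /eqP ->; exact: h.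
Qed.

Lemma tuple_mean_represented2 (R : realType) (T : finType) (n k : nat)
    (y z : T) : y != z ->
  tuple_mean (fun x : n.-tuple T =>
    (represented k y x)%:R * (represented k z x)%:R) =
  occurrence R 2 (k + k) n #|T| / (k`!%:R * k`!%:R).
Proof.
move=> yz; have := tuple_mean_prescribed R [set y; z]%SET (fun=> k) n.
have yz' : y \notin [set z]%SET by rewrite inE.
rewrite cards2 yz !big_setU1 // !big_set1 natrM => <-.
congr tuple_mean; apply/funext => x; rewrite -natrM mulnb.
congr (nat_of_bool _)%:R; apply/andP/forall_inP => [[hy hz] u|h].
  by rewrite !inE => /orP[] /eqP ->.
by split; apply: h; rewrite !inE eqxx ?orbT.
Qed.

Lemma counterE (R : realType) (T : finType) (N : {set T}) (n k : nat)
    (x : n.-tuple T) :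
  (counter N k x)%:R = \sum_(y in N) (represented k y x)%:R :> R.
Proof.
rewrite /counter -sum1_card natr_sum big_mkcond [RHS]big_mkcond.
by apply: eq_bigr => y _; rewrite inE; case: (y \in N); case: represented.
Qed.

Lemma tuple_mean_counter (R : realType) (T : finType) (N : {set T})
    (n k : nat) :
  tuple_mean (fun x : n.-tuple T => (counter N k x)%:R) =
  #|N|%:R * (occurrence R 1 k n #|T| / k`!%:R).
Proof.
under [in LHS](eq_fun (fun x => counterE R N k x)).
rewrite tuple_mean_sum (eq_bigr (fun=> occurrence R 1 k n #|T| / k`!%:R)).
  by rewrite sumr_const mulr_natl.
by move=> y _; exact: tuple_mean_represented.
Qed.

(** The square of the sum of indicators has [#|N|] diagonal terms, which are
  indicators again, and [#|N| * #|N|.-1] off-diagonal ones. *)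
Lemma tuple_mean_counter_sqr (R : realType) (T : finType) (N : {set T})
    (n k : nat) :
  tuple_mean (fun x : n.-tuple T => (counter N k x)%:R ^+ 2) =
  #|N|%:R * (occurrence R 1 k n #|T| / k`!%:R
    + #|N|.-1%:R * (occurrence R 2 (k + k) n #|T| / (k`!%:R * k`!%:R))).
Proof.
set p1 := occurrence R 1 _ _ _ / _; set p2 := occurrence R 2 _ _ _ / _.
transitivity (\sum_(y in N) (p1 + #|N|.-1%:R * p2)); last first.
  by rewrite sumr_const -[LHS]mulr_natl.
under [in LHS]eq_fun do rewrite expr2 counterE mulr_suml.
rewrite tuple_mean_sum; apply: eq_bigr => y yN.
under [in LHS]eq_fun do rewrite mulr_sumr.
rewrite tuple_mean_sum (bigD1 y) //=; congr (_ + _).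
  rewrite /p1 -(tuple_mean_represented R n k y); congr tuple_mean; apply/funext => x.
  by rewrite -natrM mulnb andbb.
rewrite (eq_bigr (fun=> p2)) => [|z /andP[_ zy]]; last first.
  by apply: tuple_mean_represented2; rewrite eq_sym.
rewrite (eq_bigl [in N :\ y]%SET) => [|z]; last by rewrite !inE andbC.
by rewrite sumr_const (cardsD1 y N) yN mulr_natl.
Qed.

Lemma counter_meanE (R : realType) (T : finType) (N : {set T}) (k : nat) :
  (0 < #|N|)%N -> counter_mean R N k = occurrence R 1 k #|N| #|T| / k`!%:R.
Proof.
move=> N0; rewrite /counter_mean; under eq_fun do rewrite mulrC.
rewrite tuple_meanZ tuple_mean_counter mulKf //.
by rewrite pnatr_eq0 -lt0n.
Qed.

Lemma counter_moment2E (R : realType) (lambda : R) (T : finType) (N : {set T})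
    (k : nat) (p1 := occurrence R 1 k #|N| #|T| / k`!%:R)
    (p2 := occurrence R 2 (k + k) #|N| #|T| / (k`!%:R * k`!%:R))
    (w := poisson_weight lambda k) :
  (0 < #|N|)%N ->
  counter_moment2 lambda N k =
  #|N|%:R^-1 * p1 + (1 - #|N|%:R^-1) * p2 - 2 * w * p1 + w ^+ 2.
Proof.
move=> N0; have NR0 : #|N|%:R != 0 :> R by rewrite pnatr_eq0 -lt0n.
rewrite /counter_moment2 -/w; clearbody w.
have -> : (fun x : #|N|.-tuple T => ((counter N k x)%:R / #|N|%:R - w) ^+ 2) =
  (fun x => (#|N|%:R ^- 2 * (counter N k x)%:R ^+ 2
    + (- 2 * w / #|N|%:R) * (counter N k x)%:R) + w ^+ 2).
  by apply/funext => x; field.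
rewrite !tuple_meanD !tuple_meanZ tuple_mean_counter tuple_mean_counter_sqr.
rewrite tuple_mean_cst ?(leq_trans N0) ?max_card // -/p1 -/p2.
by rewrite -subn1 natrB //; field.
Qed.

(** * Asymptotics along the joint limit *)

Lemma ratio_limit_near (R : realType) (lambda : R) (a : nat) :
  \forall p \near ratio_limit lambda,
    [/\ (p.2 <= p.1)%N, (a <= p.1)%N & (a <= p.2)%N].
Proof. by exists (a, 1) => [|p [? ? ? _]] /=; [exact: ltr01|split]. Qed.

Lemma ratio_limit_ratio (R : realType) (lambda : R) :
  p.2%:R / p.1%:R @[p --> ratio_limit lambda] --> lambda.
Proof.
apply/cvgrPdist_lt => e e0; exists (0%N, e) => // p [_ _ _] /=.
by rewrite distrC.
Qed.

Lemma ratio_limit_inv (R : realType) (lambda : R) (f : nat * nat -> nat) :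
  (forall a, \forall p \near ratio_limit lambda, (a <= f p)%N) ->
  (f p)%:R^-1 @[p --> ratio_limit lambda] --> (0 : R).
Proof.
move=> hf; apply/gtr0_cvgV0.
  by near=> p; rewrite ltr0n; near: p; exact: hf.
apply/cvgryPge => A; near=> p.
apply: (@le_trans _ _ (Num.truncn A).+1%:R); first exact/ltW/truncnS_gt.
by rewrite ler_nat; near: p; exact: hf.
Unshelve. all: by end_near. Qed.

Lemma ratio_limit_invM (R : realType) (lambda : R) :
  p.1%:R^-1 @[p --> ratio_limit lambda] --> (0 : R).
Proof.
apply: (ratio_limit_inv (f := fst)) => a.
by apply: filterS (ratio_limit_near lambda a) => p [].
Qed.

Lemma ratio_limit_invn (R : realType) (lambda : R) :
  p.2%:R^-1 @[p --> ratio_limit lambda] --> (0 : R).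
Proof.
apply: (ratio_limit_inv (f := snd)) => a.
by apply: filterS (ratio_limit_near lambda a) => p [].
Qed.

Lemma ratio_limit_shift (R : realType) (lambda : R) (K : nat) :
  (p.2 - K)%:R / p.1%:R @[p --> ratio_limit lambda] --> lambda.
Proof.
suff : p.2%:R / p.1%:R - K%:R * p.1%:R^-1 @[p --> ratio_limit lambda] --> lambda.
  apply: cvg_trans; apply: near_eq_cvg; near=> p.
  rewrite natrB; last by near: p; apply: filterS (ratio_limit_near lambda K) => p [].
  by rewrite mulrBl.
rewrite -[X in _ --> X]subr0 -[X in _ - X](mulr0 K%:R).
apply: cvgB; first exact: ratio_limit_ratio.
by apply: cvgMr; exact: ratio_limit_invM.
Unshelve. all: by end_near. Qed.

(** One factor at a time: n^_(K+1) / M^(K+1) gains (n - K) / M, of limit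
  [lambda]. *)
Lemma ratio_limit_ffact (R : realType) (lambda : R) (K : nat) :
  (p.2 ^_ K)%:R / (p.1 ^ K)%:R @[p --> ratio_limit lambda] --> lambda ^+ K.
Proof.
elim: K => [|K IH].
  under eq_cvg do rewrite ffactn0 expn0 divr1.
  by rewrite expr0; exact: cvg_cst.
under eq_cvg do rewrite ffactnSr expnSr !natrM invfM mulrACA.
by rewrite exprSr; apply: cvgM => //; exact: ratio_limit_shift.
Qed.

(** Both bounds come from 1 + t <= exp t, taken at t = - x for the upper one and,
  since 1 / (1 - x) = 1 + x / (1 - x), at t = x / (1 - x) for the lower one. *)
Lemma expR_bounds (R : realType) (x : R) (m : nat) : 0 <= x < 1 ->
  expR (- (m%:R * (x / (1 - x)))) <= (1 - x) ^+ m <= expR (- (m%:R * x)).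
Proof.
move=> /andP[x0 x1]; have y0 : 0 < 1 - x by rewrite subr_gt0.
rewrite -(mulrN _ (x / _)) -(mulrN _ x) !expRM_natl; apply/andP; split.
  apply: lerXn2r; rewrite ?nnegrE ?expR_ge0 ?(ltW y0) //.
  rewrite expRN -[leRHS]invrK lef_pV2 ?posrE ?invr_gt0 ?expR_gt0 //.
  apply: le_trans (expR_ge1Dx _); rewrite le_eqVlt; apply/orP; left; apply/eqP.
  by field; rewrite gt_eqF.
apply: lerXn2r; rewrite ?nnegrE ?expR_ge0 ?(ltW y0) //.
exact: expR_ge1Dx.
Qed.

(** With x = r / M, the quantity is (1 - x) ^ (n - K), and the exponents of both
  bounds of [expR_bounds] tend to - r lambda. *)
Lemma ratio_limit_pow (R : realType) (lambda : R) (r K : nat) :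
  ((p.1 - r) ^ (p.2 - K))%:R / (p.1 ^ (p.2 - K))%:R
    @[p --> ratio_limit lambda] --> expR (- (lambda * r%:R)).
Proof.
pose x (p : nat * nat) : R := r%:R * p.1%:R^-1.
have x0 : x p @[p --> ratio_limit lambda] --> (0 : R).
  rewrite -(mulr0 r%:R); apply: cvgMr; exact: ratio_limit_invM.
have mx : (p.2 - K)%:R * x p @[p --> ratio_limit lambda] --> lambda * r%:R.
  under eq_cvg do rewrite /x mulrCA.
  by rewrite mulrC; apply: cvgMr; exact: ratio_limit_shift.
have mx1 : (p.2 - K)%:R * (x p / (1 - x p)) @[p --> ratio_limit lambda]
    --> lambda * r%:R.
  under eq_cvg do rewrite mulrA.
  have -> : lambda * r%:R = lambda * r%:R / (1 - 0) by rewrite subr0 divr1.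
  apply: cvgM => //; apply: cvgV; first by rewrite subr0 oner_neq0.
  by apply: cvgB => //; exact: cvg_cst.
have cexp (f : nat * nat -> R) : f p @[p --> ratio_limit lambda] --> lambda * r%:R ->
    expR (- f p) @[p --> ratio_limit lambda] --> expR (- (lambda * r%:R)).
  move=> hf; apply: (@cvg_comp _ _ _ (fun p => - f p) expR); first exact: cvgN hf.
  exact: continuous_expR.
apply: squeeze_cvgr (cexp _ mx1) (cexp _ mx); near=> p.
have rp : (r < p.1)%N.
  by near: p; apply: filterS (ratio_limit_near lambda r.+1) => p [].
have p0 : 0 < p.1%:R :> R by rewrite ltr0n (leq_trans _ rp).
have -> : ((p.1 - r) ^ (p.2 - K))%:R / (p.1 ^ (p.2 - K))%:R
    = (1 - x p) ^+ (p.2 - K).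
  rewrite !natrX -expr_div_n natrB 1?ltnW // mulrBl divff ?gt_eqF //.
apply: expR_bounds; rewrite /x mulr_ge0 ?invr_ge0 //=.
by rewrite ltr_pdivrMr // mul1r ltr_nat.
Unshelve. all: by end_near. Qed.

Lemma ratio_limit_occurrence (R : realType) (lambda : R) (r K : nat) :
  occurrence R r K p.2 p.1 @[p --> ratio_limit lambda]
    --> lambda ^+ K * expR (- (lambda * r%:R)).
Proof.
have : (p.2 ^_ K)%:R / (p.1 ^ K)%:R *
    (((p.1 - r) ^ (p.2 - K))%:R / (p.1 ^ (p.2 - K))%:R)
    @[p --> ratio_limit lambda] --> lambda ^+ K * expR (- (lambda * r%:R)).
  by apply: cvgM; [exact: ratio_limit_ffact|exact: ratio_limit_pow].
apply: cvg_trans; apply: near_eq_cvg; near=> p.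
have Kp : (K <= p.2)%N.
  by near: p; apply: filterS (ratio_limit_near lambda K) => p [].
rewrite /occurrence (_ : (p.1 ^ p.2 = p.1 ^ K * p.1 ^ (p.2 - K))%N).
  by rewrite natrM invfM mulrACA.
by rewrite -expnD subnKC.
Unshelve. all: by end_near. Qed.

(** * Convergence *)

Theorem theorem2 (R : realType) (lambda : R) (hlambda : 0 < lambda <= 1)
    (k : nat)
    (T : nat -> nat -> finType) (N : forall M n : nat, {set T M n})
    (hT : forall M n : nat, (n <= M)%N -> #|T M n| = M)
    (hN : forall M n : nat, (n <= M)%N -> #|N M n| = n) :
  (counter_mean R (N p.1 p.2) k @[p --> ratio_limit lambda]
     --> poisson_weight lambda k) /\
  (counter_moment2 lambda (N p.1 p.2) k @[p --> ratio_limit lambda] --> 0).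
Proof.
set w := poisson_weight lambda k.
pose p1 (p : nat * nat) : R := occurrence R 1 k p.2 p.1 / k`!%:R.
pose p2 (p : nat * nat) : R :=
  occurrence R 2 (k + k) p.2 p.1 / (k`!%:R * k`!%:R).
have cp1 : p1 p @[p --> ratio_limit lambda] --> w.
  have -> : w = lambda ^+ k * expR (- (lambda * 1%:R)) / k`!%:R.
    by rewrite /w /poisson_weight mulr1 mulrAC.
  by apply: cvgM; [exact: ratio_limit_occurrence|exact: cvg_cst].
have cp2 : p2 p @[p --> ratio_limit lambda] --> w ^+ 2.
  have -> : w ^+ 2 =
      lambda ^+ (k + k) * expR (- (lambda * 2%:R)) / (k`!%:R * k`!%:R).
    rewrite /w /poisson_weight expr2 exprD mulr_natr mulr2n opprD expRD invfM.
    by ring.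
  by apply: cvgM; [exact: ratio_limit_occurrence|exact: cvg_cst].
(* the limit only sees pairs for which the sizes of [T] and [N] are known *)
have sizes : \forall p \near ratio_limit lambda,
    [/\ #|T p.1 p.2| = p.1, #|N p.1 p.2| = p.2 & (0 < #|N p.1 p.2|)%N].
  apply: filterS (ratio_limit_near lambda 1) => p [np _ n0].
  by rewrite hT ?hN.
split.
  apply: cvg_trans cp1; apply: near_eq_cvg.
  by apply: filterS sizes => p [hM hn n0]; rewrite counter_meanE // hM hn.
have lim2 : p.2%:R^-1 * p1 p + (1 - p.2%:R^-1) * p2 p - 2 * w * p1 p + w ^+ 2
    @[p --> ratio_limit lambda] --> (0 : R).
  have -> : 0 = 0 * w + (1 - 0) * w ^+ 2 - 2 * w * w + w ^+ 2 by ring.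
  have cn := @ratio_limit_invn R lambda.
  apply: cvgD; last exact: cvg_cst.
  apply: cvgB; last by apply: cvgMr.
  apply: cvgD; first exact: cvgM.
  by apply: cvgM => //; apply: cvgB => //; exact: cvg_cst.
apply: cvg_trans lim2; apply: near_eq_cvg.
by apply: filterS sizes => p [hM hn n0]; rewrite counter_moment2E // hM hn.
Qed.
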